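(* Let $0<\mu<b$, $d>0$ and $\beta$ be such that $\mathcal{P}_{(\mu,b,d,\beta)}$ is nonempty (which forces $0<\beta<1$), and put $$\tau_1=\mu-\frac{d}{2(1-\beta)},\qquad \tau_2=\mu+\frac{d}{2\beta}.$$ Then for all $t\in[0,b]$ $$\inf_{\mathbb{P}\in\mathcal{P}_{(\mu,b,d,\beta)}}\mathbb{P}(X> t)=\begin{cases}1-\frac{d}{2(\mu-t)}, & t\in[0,\tau_1],\\ \beta, & t\in[\tau_1,\mu),\\ \frac{\beta(\mu-t)}{b-t}+\frac{d}{2(b-t)}, & t\in[\mu,\tau_2],\\ 0, & t\in[\tau_2,b],\end{cases}$$ where at points belonging to several intervals the last applicable case is used.
   Context: $\mathcal{P}_{(\mu,b,d,\beta)}$ is the set of all Borel probability measures $\mathbb{P}$ (the distribution of a real random variable $X$) such that $\mathbb{P}(X\in[0,b])=1$, $\mathbb{E}_{\mathbb{P}}[X]=\mu$, $\mathbb{E}_{\mathbb{P}}[|X-\mu|]=d$ and $\mathbb{P}(X\ge\mu)=\beta$. *)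

(* Defs.v *)
From HB Require Import structures.
From mathcomp Require Import all_boot all_order all_algebra.
From mathcomp Require Import all_classical all_reals all_analysis.

Set Implicit Arguments.
Unset Strict Implicit.
Unset Printing Implicit Defensive.

Import Order.TTheory GRing.Theory Num.Theory.
Import numFieldNormedType.Exports.

Local Open Scope classical_set_scope.
Local Open Scope ring_scope.

(* The random variable is the identity on the real line, so that [P] is
   its distribution. *)
Definition ambiguity_set (R : realType) (mu b d beta : R) :
    set (probability (measurableTypeR R) R) :=
  [set P : probability (measurableTypeR R) R |
    [/\ P `[0, b]%classic = 1%:E,
        'E_P[fun x : R => x]%E = mu%:E,
        'E_P[fun x : R => `|x - mu|%R]%E = d%:E
      & P `[mu, +oo[%classic = beta%:E]].

Definition tau1 (R : realType) (mu d beta : R) : R :=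
  mu - d / (2 * (1 - beta)).

Definition tau2 (R : realType) (mu d beta : R) : R :=
  mu + d / (2 * beta).

(* The intervals share endpoints; the tests run from the last one to the
   first, so that the last applicable case wins. The remaining points of
   [0, b] are those of [0, tau1[. *)
Definition tail_bound (R : realType) (mu b d beta t : R) : R :=
  if t \in `[tau2 mu d beta, b] then 0
  else if t \in `[mu, tau2 mu d beta] then
    beta * (mu - t) / (b - t) + d / (2 * (b - t))
  else if t \in `[tau1 mu d beta, mu[ then beta
  else 1 - d / (2 * (mu - t)).

(* Main.v *)
Require Import Defs.
From HB Require Import structures.
From mathcomp Require Import all_boot all_order all_algebra.
From mathcomp Require Import all_classical all_reals all_analysis.
From mathcomp Require Import measurable_realfun.
From mathcomp Require Import ring lra.

Set Implicit Arguments.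
Unset Strict Implicit.
Unset Printing Implicit Defensive.

Import Order.TTheory GRing.Theory Num.Theory.
Import numFieldNormedType.Exports.

Local Open Scope classical_set_scope.
Local Open Scope ring_scope.

(** The problem is a linear program over distributions: the mass, the mean,
    the mean absolute deviation and P(X >= mu) are prescribed, and P(X > t)
    is minimised. Both halves of the proof are those of linear programming.

    Lower bound. A function k0 + k1 x + k2 |x - mu| + k3 1(x >= mu) +
    k4 1(x > t) that is nonnegative on [0, b] has a nonnegative expectation,
    and this expectation is k0 + k1 mu + k2 d + k3 beta + k4 P(X > t); so each
    such function with k4 > 0 bounds P(X > t) from below ([weak_duality]).
    Since E[X] = mu, the positive and negative parts of X - mu both have
    expectation d / 2, and the useful test functions come from comparing these
    parts with indicators:
    - if t < mu, then (mu - X)^+ >= (mu - t) 1(X <= t), and also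
      1(X > t) >= 1(X >= mu);
    - if t >= mu, then
      (X - mu)^+ <= (t - mu) 1(X >= mu) + (b - t) 1(X > t).
    The cruder comparisons (X - mu)^+ <= (b - mu) 1(X >= mu) and
    (mu - X)^+ <= mu 1(X < mu) show that a nonempty ambiguity set forces
    0 < beta < 1, 0 <= tau1 and tau2 <= b ([ambiguity_feasible]).

    Optimality. tau1 and tau2 are the conditional means of X given X < mu and
    X >= mu. The two-point law on them settles the cases t >= tau2 and
    tau1 <= t < mu. If mu <= t < tau2, the upper atom is split between t and b.
    If t < tau1, equality would put the lower part on t and mu, but mass at mu
    counts in P(X >= mu); hence the infimum is not attained, only approached, by
    moving this atom to mu - eps ([tail_bound_approx]). *)

(** * Moment duality and the lower bounds *)

(** The integral of a function that is nonnegative on a set of full measure is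
    nonnegative; linearity rewrites it in terms of the prescribed moments. *)
Lemma weak_duality (R : realType) (mu b d beta k0 k1 k2 k3 k4 t p : R)
    (P : probability (measurableTypeR R) R) :
    ambiguity_set mu b d beta P -> P `]t, +oo[%classic = p%:E ->
    (forall x : R, 0 <= x -> x <= b ->
      0 <= k0 + k1 * x + k2 * `|x - mu| + k3 * (mu <= x)%R%:R
           + k4 * (t < x)%R%:R) ->
  0 <= k0 + k1 * mu + k2 * d + k3 * beta + k4 * p.
Proof.
move=> [P0b EX Ed Pmu] Pt h_ge0.
have mid : measurable_fun setT (fun x : measurableTypeR R => x : R).
  exact: measurable_id.
have mabs : measurable_fun setT (fun x : measurableTypeR R => `|x - mu|).
  by apply: measurableT_comp => //; exact: measurable_funB.
(* |x - mu| is nonnegative, so its finite integral gives integrability; that *)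
(* of x is deduced from it. *)
have int_abs : P.-integrable setT (fun x : measurableTypeR R => (`|x - mu|)%:E).
  apply/integrableP; split; first exact/measurable_EFinP.
  under eq_integral do rewrite /= normr_id.
  by rewrite unlock in Ed; rewrite Ed ltry.
have int_dev : P.-integrable setT (fun x : measurableTypeR R => (x - mu)%:E).
  apply/integrableP; split; first exact/measurable_EFinP/measurable_funB.
  by move/integrableP: int_abs => [_]; under eq_integral do rewrite /= normr_id.
have int_id : P.-integrable setT (fun x : measurableTypeR R => x%:E).
  have := integrableD measurableT int_dev
    (finite_measure_integrable_cst P mu measurableT).
  by apply: eq_integrable => // x _ /=; rewrite -EFinD subrK.
have L1id : (fun x : measurableTypeR R => x : R) \in Lfun P 1.
  exact/Lfun1_integrable.
have L1abs : (fun x : measurableTypeR R => `|x - mu|) \in Lfun P 1.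
  exact/Lfun1_integrable.
have L1ind A : measurable A -> (\1_A : measurableTypeR R -> R) \in Lfun P 1.
  by move=> mA; apply/Lfun1_integrable; exact: integrable_indic.
have L1cst : (cst k0 : measurableTypeR R -> R) \in Lfun P 1.
  by apply/Lfun1_integrable; exact: finite_measure_integrable_cst.
have mI (A : interval R) : measurable ([set` A] : set (measurableTypeR R)).
  exact: measurable_itv.
pose h : measurableTypeR R -> R :=
  cst k0 \+ (k1 \o* (fun x => x)) \+ (k2 \o* (fun x => `|x - mu|))
  \+ (k3 \o* \1_`[mu, +oo[%classic) \+ (k4 \o* \1_`]t, +oo[%classic).
have hE x : h x = k0 + k1 * x + k2 * `|x - mu| + k3 * (mu <= x)%R%:R
    + k4 * (t < x)%R%:R.
  rewrite /h /= !indicE !mem_setE !in_itv /= !andbT; ring.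
have [L1h Eh] : h \in Lfun P 1 /\
    ('E_P[h] = (k0 + k1 * mu + k2 * d + k3 * beta + k4 * p)%:E)%E.
  split; first by rewrite !(rpredD, Lfun_scale, L1ind).
  rewrite !expectationD ?expectationZl ?(rpredD, Lfun_scale, L1ind)//.
  rewrite expectation_cst EX Ed !expectation_indic// Pmu Pt.
  by rewrite -!EFinM -!EFinD.
(* The test function may be negative outside [0, b], a null set. *)
have mhole : measurable (~` `[0, b]%classic : set (measurableTypeR R)).
  exact: measurableC.
have hole0 : P (~` `[0, b]%classic) = 0%E.
  by rewrite probability_setC// P0b subee.
rewrite -lee_fin -Eh unlock (negligible_integral mhole)//; last first.
  exact/Lfun1_integrable.
rewrite integral_ge0// => x [_ /= /contrapT].
by rewrite in_itv /= => /andP[x0 xb]; rewrite lee_fin hE h_ge0.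
Qed.

Lemma tail_fin (R : realType) (P : probability (measurableTypeR R) R)
    (t : R) : exists p, P `]t, +oo[%classic = p%:E.
Proof.
exists (fine (P `]t, +oo[%classic)); rewrite fineK//.
by apply: fin_num_measure; exact: measurable_itv.
Qed.

(** Both one-sided deviations have expectation d / 2 > 0, so X charges both
    sides of mu, and the room available on each side, b - mu and mu, limits d.
    The tail plays no part in this (k4 = 0), hence the arbitrary threshold 0. *)
Lemma ambiguity_feasible (R : realType) (mu b d beta : R) :
    0 < mu -> mu < b -> 0 < d -> ambiguity_set mu b d beta !=set0 ->
  [/\ 0 < beta < 1, 0 <= tau1 mu d beta & tau2 mu d beta <= b].
Proof.
move=> mu_gt0 mu_lt_b d_gt0 [P Pin]; have [p Pp] := tail_fin P 0.
(* (X - mu)^+ <= (b - mu) 1(X >= mu) *)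
have d_le_above : d / 2 <= beta * (b - mu).
  lapply (@weak_duality _ mu b d beta (mu / 2) (- (1 / 2)) (- (1 / 2)) (b - mu)
    0 0 p P Pin Pp); first lra.
  move=> x x0 xb.
  by case: (leP mu x) => ? /=; [rewrite ger0_norm|rewrite ltr0_norm]; lra.
(* (mu - X)^+ <= mu 1(X < mu) *)
have d_le_below : d / 2 <= (1 - beta) * mu.
  lapply (@weak_duality _ mu b d beta (mu / 2) (1 / 2) (- (1 / 2)) (- mu)
    0 0 p P Pin Pp); first lra.
  move=> x x0 xb.
  by case: (leP mu x) => ? /=; [rewrite ger0_norm|rewrite ltr0_norm]; lra.
have beta_gt0 : 0 < beta.
  rewrite -(pmulr_lgt0 _ (_ : 0 < b - mu)); lra.
have beta_lt1 : beta < 1.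
  by rewrite -subr_gt0 -(pmulr_lgt0 _ mu_gt0); lra.
split.
- by rewrite beta_gt0.
- by rewrite /tau1 subr_ge0 invfM mulrA ler_pdivrMr; lra.
- by rewrite /tau2 -lerBrDl invfM mulrA ler_pdivrMr; lra.
Qed.

(** Apart from the trivial bound 0, each branch is the duality for a comparison
    that is an equality on the support of the extremal law, or, for t < tau1,
    of the limit t, mu, tau2 of the nearly extremal ones. *)
Lemma tail_bound_le (R : realType) (mu b d beta t p : R)
    (P : probability (measurableTypeR R) R) :
    ambiguity_set mu b d beta P -> t <= b -> tau2 mu d beta <= b ->
    P `]t, +oo[%classic = p%:E ->
  tail_bound mu b d beta t <= p.
Proof.
move=> Pin t_le_b tau2_le_b Pp.
have dual k0 k1 k2 k3 k4 := @weak_duality _ mu b d beta k0 k1 k2 k3 k4 t p P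
  Pin Pp.
rewrite /tail_bound !in_itv/= t_le_b andbT.
case: (leP (tau2 _ _ _) t) => [_|t_tau2].
  by rewrite -lee_fin -Pp.
rewrite (ltW t_tau2) andbT.
case: (leP mu t) => [mu_t|t_mu].
- have bt0 : 0 < b - t by lra.
  suff : beta * (mu - t) + d / 2 <= p * (b - t).
    by rewrite -ler_pdivrMr// mulrDl -(mulrA d) -invfM.
  (* (X - mu)^+ <= (t - mu) 1(X >= mu) + (b - t) 1(X > t) *)
  lapply (dual (mu / 2) (- (1 / 2)) (- (1 / 2)) (t - mu) (b - t)); first lra.
  move=> x x0 xb.
  case: (leP mu x) => ? /=; [rewrite ger0_norm|rewrite ltr0_norm];
    by [case: (ltP t x) => ? /=; lra|lra].
- rewrite andbT; case: (leP (tau1 _ _ _) t) => _.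
  (* 1(X > t) >= 1(X >= mu) *)
  + lapply (dual 0 0 0 (- 1) 1); first lra.
    move=> x x0 xb.
    by case: (leP mu x) => ?; case: (ltP t x) => ? /=; lra.
  + have mt0 : 0 < mu - t by lra.
    suff : (1 - p) * (mu - t) <= d / 2.
      rewrite -ler_pdivlMr// -mulrA -invfM; lra.
    (* (mu - X)^+ >= (mu - t) 1(X <= t) *)
    lapply (dual (mu / 2 - (mu - t)) (- (1 / 2)) (1 / 2) 0 (mu - t)); first lra.
    move=> x x0 xb.
    case: (leP mu x) => ? /=; [rewrite ger0_norm|rewrite ltr0_norm];
      by [case: (ltP t x) => ? /=; lra|lra].
Qed.

(** * Finitely supported distributions *)

(** A list of weighted atoms, possibly with repetitions and zero weights, is a
    convenient encoding of the laws used as witnesses: probabilities and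
    expectations become explicit finite sums. *)
Lemma atomic_probability (disp : measure_display) (T : measurableType disp)
    (R : realType) (s : seq (R * T)) :
    all (fun z => 0 <= z.1) s -> \sum_(z <- s) z.1 = 1 ->
  exists P : probability T R,
    (forall A, measurable A -> P A = (\sum_(z <- s) z.1 * \1_A z.2)%:E) /\
    (forall f : T -> R, measurable_fun setT f ->
       'E_P[f]%E = (\sum_(z <- s) z.1 * f z.2)%:E).
Proof.
move=> w_ge0 w_sum1.
pose z i := nth (0, point) s i.
(* The absolute value makes the weights nonnegative by typing, also at the *)
(* indices beyond the size of s. *)
pose w i : {nonneg R} := NngNum (normr_ge0 (z i).1).
pose m i : {measure set T -> \bar R} :=
  mscale (w i) \d_(z i).2.
have wE i : (i < size s)%N -> `|(z i).1| = (z i).1.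
  by move=> i_s; rewrite ger0_norm//; exact: (all_nthP (0, point) w_ge0).
have sumE (g : T -> R) :
    (\sum_(i < size s) (`|(z i).1| * g (z i).2)%:E =
     (\sum_(z <- s) z.1 * g z.2)%:E)%E.
  rewrite sumEFin (big_nth (0, point)) big_mkord; congr EFin.
  by apply: eq_bigr => i _; rewrite wE.
pose nu := msum m (size s).
have nuE A : measurable A -> nu A = (\sum_(z <- s) z.1 * \1_A z.2)%:E.
  by move=> _; rewrite -sumE.
have nu1 : nu setT = 1%E.
  rewrite nuE//; under eq_bigr do rewrite indicT mulr1.
  by rewrite w_sum1.
pose P : probability T R :=
  HB.pack (msum m (size s))
    (Measure_isProbability.Build _ _ _ nu nu1).
have ge0E (g : T -> \bar R) : measurable_fun setT g ->
    (forall x, 0 <= g x)%E ->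
    (\int[P]_x g x = \sum_(i < size s) `|(z i).1|%:E * g (z i).2)%E.
  move=> mg g0; rewrite ge0_integral_measure_sum//; apply: eq_bigr => i _.
  by rewrite ge0_integral_mscale// integral_dirac// diracT mul1e.
exists P; split=> // f mf.
rewrite unlock integralE !ge0E//=; last 2 first.
- exact/measurable_funeneg/measurable_EFinP.
- exact/measurable_funepos/measurable_EFinP.
under eq_bigr do rewrite funeposE /= -EFin_max -EFinM.
under [X in (_ - X)%E]eq_bigr do rewrite funenegE /= -EFin_max -EFinM.
rewrite (sumE (fun x => Num.max (f x) 0)) (sumE (fun x => Num.max (- f x) 0)).
rewrite -EFinB -sumrB; congr EFin; apply: eq_bigr => i _.
rewrite -mulrBr; congr (_ * _); rewrite !maxEle oppr_le0.
by case: leP => ?; case: leP => ?; lra.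
Qed.

Lemma atomic_ambiguity (R : realType) (mu b d beta : R) (s : seq (R * R)) :
    all (fun z => [&& 0 <= z.1, 0 <= z.2 & z.2 <= b]) s ->
    \sum_(z <- s) z.1 = 1 -> \sum_(z <- s) z.1 * z.2 = mu ->
    \sum_(z <- s) z.1 * `|z.2 - mu| = d ->
    \sum_(z <- s) z.1 * (mu <= z.2)%R%:R = beta ->
  exists2 P, ambiguity_set mu b d beta P &
    forall t, P `]t, +oo[%classic = (\sum_(z <- s) z.1 * (t < z.2)%R%:R)%:E.
Proof.
move=> s_ok sum1 sum_mu sum_d sum_beta.
have w_ge0 : all (fun z : R * R => 0 <= z.1) s.
  by apply: sub_all s_ok => z /and3P[].
have [P [PE EE]] := @atomic_probability _ (measurableTypeR R) R s w_ge0 sum1.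
have mI (A : interval R) : measurable ([set` A] : set (measurableTypeR R)).
  exact: measurable_itv.
exists P; last first.
  move=> t; rewrite PE//; congr EFin; apply: eq_bigr => z _.
  by rewrite indicE mem_setE in_itv/= andbT.
split.
- rewrite PE// -sum1; congr EFin; apply: eq_big_seq => z zs.
  have /and3P[_ z0 zb] := allP s_ok z zs.
  by rewrite indicE mem_setE in_itv/= z0 zb mulr1.
- by rewrite EE ?sum_mu//; exact: measurable_id.
- rewrite EE ?sum_d//; apply: measurableT_comp => //.
  by apply: measurable_funB => //; exact: measurable_id.
- rewrite PE// -sum_beta; congr EFin; apply: eq_bigr => z _.
  by rewrite indicE mem_setE in_itv/= andbT.
Qed.

(** * Extremal distributions and the worst-case tail *)

(** The slack e serves only t < tau1, where the limiting law has an atom at mu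
    that should count as lying below mu; the other cases exhibit a minimiser. *)
Lemma tail_bound_approx (R : realType) (mu b d beta t e : R) :
    0 < mu -> mu < b -> 0 < d -> 0 < beta < 1 ->
    0 <= tau1 mu d beta -> tau2 mu d beta <= b ->
    0 <= t -> t <= b -> 0 < e ->
  exists2 P, ambiguity_set mu b d beta P &
    (P `]t, +oo[%classic <= (tail_bound mu b d beta t + e)%:E)%E.
Proof.
move=> mu_gt0 mu_lt_b d_gt0 /andP[beta_gt0 beta_lt1] tau1_ge0 tau2_le_b
  t_ge0 t_le_b e_gt0.
have low : (1 - beta) * (mu - tau1 mu d beta) = d / 2.
  by rewrite /tau1; field; lra.
have high : beta * (tau2 mu d beta - mu) = d / 2.
  by rewrite /tau2; field; lra.
have tau1_lt : tau1 mu d beta < mu.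
  by rewrite -subr_gt0 -(pmulr_rgt0 _ (_ : 0 < 1 - beta)) ?low; lra.
have tau2_gt : mu < tau2 mu d beta.
  by rewrite -subr_gt0 -(pmulr_rgt0 _ beta_gt0) high; lra.
rewrite /tail_bound !in_itv/= t_le_b andbT.
set u := tau1 mu d beta in low tau1_lt tau1_ge0 *.
set v := tau2 mu d beta in high tau2_gt tau2_le_b *.
have two_point : exists2 P, ambiguity_set mu b d beta P &
    forall t, P `]t, +oo[%classic =
      ((1 - beta) * (t < u)%R%:R + beta * (t < v)%R%:R)%:E.
  have [||||//|P Pin PE] := @atomic_ambiguity _ mu b d beta
    [:: (1 - beta, u); (beta, v)]; rewrite ?big_cons ?big_nil/=.
  - lra.
  - lra.
  - lra.
  - rewrite ltr0_norm ?gtr0_norm; lra.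
  - rewrite leNgt tau1_lt (ltW tau2_gt)/=; lra.
  - by exists P => // t'; rewrite PE !big_cons big_nil/= addr0.
case: (leP v t) => [v_t|t_v].
  case: two_point => P Pin PE; exists P => //.
  rewrite PE lee_fin !ltNge v_t.
  by rewrite (le_trans (ltW (lt_trans tau1_lt tau2_gt)) v_t)/=; lra.
rewrite (ltW t_v) andbT.
case: (leP mu t) => [mu_t|t_mu].
(* The upper part has mass beta and mean tau2 > t; q is the mass at b that *)
(* realises this mean when the remaining mass sits at t. *)
- set q := (X in X + e).
  have bt0 : 0 < b - t by lra.
  have qE : q * (b - t) = beta * (mu - t) + d / 2.
    by rewrite /q; field; lra.
  have q_ge0 : 0 <= q.
    rewrite -(pmulr_lge0 _ bt0) qE -high.
    by have := ler_wpM2l (ltW beta_gt0) (ltW t_v); lra.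
  have q_le : q <= beta.
    rewrite -(ler_pM2r bt0) qE -high.
    by have := ler_wpM2l (ltW beta_gt0) tau2_le_b; lra.
  have [||||//|P Pin PE] := @atomic_ambiguity _ mu b d beta
    [:: (1 - beta, u); (beta - q, t); (q, b)]; rewrite ?big_cons ?big_nil/=.
  + lra.
  + lra.
  + lra.
  + rewrite ltr0_norm ?ger0_norm; lra.
  + rewrite leNgt tau1_lt mu_t (ltW mu_lt_b)/=; lra.
  + exists P => //; rewrite PE lee_fin !big_cons big_nil/=.
    rewrite ltxx ltNge (ltW (lt_le_trans tau1_lt mu_t))/=.
    by case: (t < b) => /=; lra.
- rewrite andbT; case: (leP u t) => [u_t|t_u].
    case: two_point => P Pin PE; exists P => //.
    by rewrite PE lee_fin ltNge u_t t_v/=; lra.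
  have mt0 : 0 < mu - t by lra.
  (* p0 is the extremal value of P(X <= t). The mass p placed at t stays *)
  (* below p0, and eps is then fixed by the mean deviation below mu. *)
  pose p0 := d / (2 * (mu - t)).
  have p0E : p0 * (mu - t) = d / 2 by rewrite /p0; field; lra.
  pose p := Num.max 0 (p0 - e).
  have p0_gt0 : 0 < p0 by rewrite divr_gt0//; lra.
  have p_ge0 : 0 <= p by rewrite le_max lexx.
  have p_ge : p0 - e <= p by rewrite le_max lexx orbT.
  have p_lt : p < p0 by rewrite gt_max p0_gt0; lra.
  have p0_lt : p0 < 1 - beta.
    rewrite -(ltr_pM2r mt0) p0E -low ltr_pM2l; lra.
  have rest_gt0 : 0 < 1 - beta - p by lra.
  pose eps := (d / 2 - p * (mu - t)) / (1 - beta - p).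
  have epsE : (1 - beta - p) * eps = d / 2 - p * (mu - t).
    by rewrite /eps; field; lra.
  have eps_gt0 : 0 < eps.
    by rewrite divr_gt0// subr_gt0 -p0E ltr_pM2r.
  have eps_lt : eps < mu - t.
    rewrite -(ltr_pM2l rest_gt0) epsE -p0E -mulrBl ltr_pM2r//; lra.
  have [||||//|P Pin PE] := @atomic_ambiguity _ mu b d beta
    [:: (p, t); (1 - beta - p, mu - eps); (beta, v)];
    rewrite ?big_cons ?big_nil/=.
  + lra.
  + lra.
  + lra.
  + rewrite (@ltr0_norm _ (t - mu)) ?(@ltr0_norm _ (mu - eps - mu)) ?gtr0_norm;
      lra.
  + rewrite leNgt t_mu (ltW tau2_gt) leNgt/=.
    have -> : mu - eps < mu by lra.
    by rewrite /=; lra.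
  + exists P => //; rewrite PE lee_fin !big_cons big_nil/= ltxx t_v.
    have -> : t < mu - eps by lra.
    by rewrite -/p0 /=; lra.
Qed.

Theorem theorem4 (R : realType) (mu b d beta : R)
    (mu_gt0 : 0 < mu) (mu_lt_b : mu < b) (d_gt0 : 0 < d)
    (nonempty : ambiguity_set mu b d beta !=set0) :
  0 < beta < 1 /\
  forall t : R, t \in `[0, b] ->
    ereal_inf [set (P : probability (measurableTypeR R) R) `]t, +oo[%classic
              | P in ambiguity_set mu b d beta]
    = (tail_bound mu b d beta t)%:E.
Proof.
have [beta01 tau1_ge0 tau2_le_b] :=
  ambiguity_feasible mu_gt0 mu_lt_b d_gt0 nonempty.
split=> // t; rewrite in_itv/= => /andP[t_ge0 t_le_b].
apply/eqP; rewrite eq_le; apply/andP; split.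
- apply/lee_addgt0Pr => e e_gt0; apply: ge_ereal_inf.
  have [P Pin P_le] := tail_bound_approx mu_gt0 mu_lt_b d_gt0 beta01 tau1_ge0
    tau2_le_b t_ge0 t_le_b e_gt0.
  by exists (P `]t, +oo[%classic) => //; exists P.
- apply/ereal_infP => _ [P Pin <-].
  have [p Pp] := tail_fin P t.
  by rewrite Pp lee_fin; exact: tail_bound_le Pin t_le_b tau2_le_b Pp.
Qed.
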